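(* Let $A$ and $B$ be Banach algebras and let $\phi\in Hom(B,\mathbb{C})$. Then $A^{\ast\ast}\oplus_\phi B^{\ast\ast}$ is isometrically and algebraically isomorphic to the bidual algebra $(A\oplus_\phi B)^{\ast\ast}$.
   Context: $Hom(B,\mathbb{C})$ is the set of all nonzero homomorphisms from $B$ into $\mathbb{C}$. $A\oplus_\phi B$ is the Banach algebra of all ordered pairs $(a,b)$, $a\in A$, $b\in B$, with coordinatewise addition and scalar multiplication, product $(a_1,a_2)\cdot_\phi(b_1,b_2)=(a_1b_1+\phi(a_2)b_1+\phi(b_2)a_1,\ a_2b_2)$, and norm $\|(a_1,a_2)\|_{\oplus_\phi}=\|a_1\|+\|a_2\|$. For a Banach algebra $C$, the bidual $C^{\ast\ast}$ is a Banach algebra under the following Arens product: for $f\in C^\ast$, $a,b\in C$, $m,n\in C^{\ast\ast}$, $\langle f\cdot a,b\rangle=\langle f,ab\rangle$, $\langle m\cdot f,a\rangle=\langle m,f\cdot a\rangle$, $\langle n\cdot m,f\rangle=\langle n,m\cdot f\rangle$. The algebra $(A\oplus_\phi B)^{\ast\ast}$ carries this Arens product. $A^{\ast\ast}\oplus_\phi B^{\ast\ast}$ (with $A^{\ast\ast},B^{\ast\ast}$ carrying the Arens product) is the algebra of all pairs $(m_1,m_2)$, $m_1\in A^{\ast\ast}$, $m_2\in B^{\ast\ast}$, with coordinatewise linear operations, product $(m_1,m_2)\odot_\phi(m_1',m_2')=(m_1\cdot m_1'+m_2(\phi)m_1'+m_2'(\phi)m_1,\ m_2\cdot m_2')$,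 and norm $\|(m_1,m_2)\|=\|m_1\|+\|m_2\|$. *)

(* Defs.v *)
From HB Require Import structures.
From mathcomp Require Import all_boot all_order all_algebra complex.
From mathcomp Require Import boolp classical_sets functions reals.
From mathcomp Require Import topology normedtype sequences ring.

Set Implicit Arguments.
Unset Strict Implicit.
Unset Printing Implicit Defensive.

Import Order.TTheory GRing.Theory Num.Theory.
Import numFieldNormedType.Exports.

Local Open Scope classical_set_scope.
Local Open Scope ring_scope.
Local Open Scope complex_scope.

Reserved Notation "x ** y" (at level 40, left associativity).

HB.mixin Record CompleteNormedModule_isBanachAlgebra (K : numFieldType) A
    & CompleteNormedModule K A := {
  bmul : A -> A -> A;
  bmulA : associative bmul;
  bmulDl : left_distributive bmul +%R;
  bmulDr : right_distributive bmul +%R;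
  bscaleAl : forall (k : K) x y, k *: bmul x y = bmul (k *: x) y;
  bscaleAr : forall (k : K) x y, k *: bmul x y = bmul x (k *: y);
  bnormM : forall x y, `|bmul x y| <= `|x| * `|y|
}.

(* Banach algebras need not have a unit *)
#[short(type="banachAlgType")]
HB.structure Definition BanachAlgebra (K : numFieldType) :=
  {A of CompleteNormedModule K A & CompleteNormedModule_isBanachAlgebra K A}.

Notation "x ** y" := (bmul x y) : ring_scope.

(* No continuity is required here: it is automatic, see nzhom_le below. *)
Record nzHom (K : numFieldType) (B : banachAlgType K) := NzHom {
  nzhom :> {linear B -> K^o};
  nzhomM : forall x y, nzhom (x ** y) = nzhom x * nzhom y;
  nzhom_neq0 : exists b, nzhom b != 0
}.

Section complete.
Variable R : realType.

Lemma lec_eps (x y : R[i]) : x \is Num.real -> y \is Num.real ->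
  (forall e : R[i], 0 < e -> x <= y + e) -> x <= y.
Proof.
move=> xr yr h; case: (real_leP xr yr) => // yx.
have := h ((x - y) / 2) _; rewrite divr_gt0 ?subr_gt0// => /(_ isT).
rewrite -lerBlDl => xy2; have : x - y > 0 by rewrite subr_gt0.
move: xy2; set d := x - y => d2 d0.
have : d / 2 < d by rewrite ltr_pdivrMr// ltr_pMr// ltr1n.
by move=> /(le_lt_trans d2); rewrite ltxx.
Qed.

(* norms are preserved by limits *)
Lemma cvg_dist_le (V : normedModType R[i]) (T : Type) (F : set_system T)
    {FF : ProperFilter F} (u : T -> V) (l c : V) (M : R[i]) :
  u @ F --> l -> M \is Num.real -> (\forall t \near F, `|c - u t| <= M) ->
  `|c - l| <= M.
Proof.
move=> ul Mr h; apply: lec_eps => // [|e e0]; first by rewrite normr_real.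
have /cvgrPdist_lt/(_ e e0) ule := ul.
have [t [h1 h2]] := filter_ex (filterI h ule).
rewrite -[c - l](subrKA (u t)) (le_trans (ler_normD _ _))// lerD//.
by rewrite distrC ltW.
Qed.

Lemma complex_complete (F : set_system R[i]^o) :
  ProperFilter F -> cauchy F -> cvg F.
Proof.
move=> FF /cauchyP Fc.
have ReIm (z : R[i]) : `|complex.Re z|%:C <= `|z| /\ `|complex.Im z|%:C <= `|z|.
  split; first exact: normc_ge_Re.
  have := normc_ge_Re (z * 'i%C); rewrite ReiNIm normrN normrM.
  suff -> : `|'i%C : R[i]| = 1 by rewrite mulr1.
  by rewrite normc_def /= expr0n /= add0r expr1n sqrtr1.
have FRe (P : R[i] -> R) : (forall x y, P (x - y) = P x - P y) ->
    (forall z, `|P z|%:C <= `|z|) -> cvg (P @ F).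
  move=> PB Ple; apply: cauchy_cvg; apply/cauchyP => e e0.
  have [|x Fx] := Fc e%:C; first by rewrite ltcR.
  exists (P x); suff: F (P @^-1` ball (P x) e) by [].
  apply: filterS Fx => y; rewrite /preimage -!ball_normE /= => xy.
  by rewrite -PB -ltcR (le_lt_trans (Ple _)).
have /cvg_ex[a aF] :=
  FRe (@complex.Re R) (fun x y => raddfB _ _ _) (fun z => (ReIm z).1).
have /cvg_ex[b bF] :=
  FRe (@complex.Im R) (fun x y => raddfB _ _ _) (fun z => (ReIm z).2).
apply/cvg_ex; exists (a +i* b); apply/cvgrPdist_lt => e e0.
have er : e = (complex.Re e)%:C by rewrite RRe_real// gtr0_real.
have e20 : 0 < complex.Re e / 2 by rewrite divr_gt0// -ltcR -er.
have /cvgrPdist_lt/(_ _ e20) ha := aF.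
have /cvgrPdist_lt/(_ _ e20) hb := bF.
apply: filterS2 ha hb => z /= za zb.
have -> : a +i* b - z = (a - complex.Re z)%:C + 'i%C * (b - complex.Im z)%:C.
  by rewrite [LHS]complexE; case: z {za zb}.
rewrite (le_lt_trans (ler_normD _ _))// normrM.
have -> : `|'i%C : R[i]| = 1.
  by rewrite normc_def /= expr0n /= add0r expr1n sqrtr1.
have nR (x : R) : `|x%:C| = `|x|%:C.
  by rewrite normc_def /= expr0n /= addr0 sqrtr_sqr.
by rewrite mul1r !nR er -rmorphD /= ltcR [ltRHS]splitr ltrD.
Qed.

End complete.

Section dual_type.
Variables (R : realType) (X : normedModType R[i]).

Definition cont_linear : {pred X -> R[i]^o} :=
  fun f => `[< linear f /\ continuous f >].

Record dual := Dual { dual_fun :> X -> R[i]^o; _ : dual_fun \in cont_linear }.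

HB.instance Definition _ := [isSub for dual_fun].
HB.instance Definition _ := [Choice of dual by <:].

Lemma cont_linear_submod : submod_closed cont_linear.
Proof.
split=> [|k f g].
  apply/asboolP; split => [a x y|]; last exact: cst_continuous.
  by rewrite /= scaler0 addr0.
move=> /asboolP[lf cf] /asboolP[lg cg]; apply/asboolP; split=> [a x y|x].
  rewrite !fctE /= lf lg /= !scalerDr !scalerA mulrC.
  by rewrite addrACA.
rewrite /continuous_at; apply: cvgD; last exact: cg.
by apply: cvgZr; exact: cf.
Qed.

HB.instance Definition _ :=
  GRing.isSubmodClosed.Build _ _ cont_linear cont_linear_submod.
HB.instance Definition _ := [SubChoice_isSubLmodule of dual by <:].

Implicit Types f g : dual.

Lemma dual_linear f : linear f.
Proof. by case: f => f /= /asboolP[]. Qed.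

HB.instance Definition _ f :=
  GRing.isLinear.Build R[i] X R[i]^o _ (dual_fun f) (dual_linear f).

Lemma dual_scale f k x : f (k *: x) = k * f x. Proof. exact: linearZ. Qed.

Lemma dual_continuous f : continuous f.
Proof. by case: f => f /= /asboolP[]. Qed.

Lemma dualP f g : (forall x, f x = g x) -> f = g.
Proof. by move=> fg; apply/val_inj/funext. Qed.

Lemma dualDE f g x : (f + g) x = f x + g x. Proof. by []. Qed.
Lemma dualZE k f x : (k *: f) x = k * f x. Proof. by []. Qed.

(* Operator norm. Norms over R[i] are R[i]-valued, hence the supremum of the
   real parts and the injection into R[i]. *)
Definition dual_norm f : R[i] :=
  (sup [set complex.Re `|f x| | x in [set x : X | `|x| <= 1]])%:C.

Lemma normRe (z : R[i]) : `|z| = (complex.Re `|z|)%:C.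
Proof. by rewrite RRe_real ?normr_real. Qed.

Lemma dual_has_sup f :
  has_sup [set complex.Re `|f x| | x in [set x : X | `|x| <= 1]].
Proof.
split; first by exists (complex.Re `|f 0|), 0 => //=; rewrite normr0.
have /linear_bounded_continuous/linear_boundedP : continuous f.
  exact: dual_continuous.
move=> /pinfty_ex_gt0[M M0 fM]; exists (complex.Re M) => _ [x /= x1 <-].
rewrite -lecR -normRe RRe_real ?gtr0_real// (le_trans (fM x))//.
by rewrite ger_pMr.
Qed.

Lemma dual_norm_ge0 f : 0 <= dual_norm f.
Proof.
rewrite /dual_norm lecR -[leLHS](_ : complex.Re `|f 0| = 0); last first.
  by apply: complexI; rewrite -normRe linear0 normr0.
by apply: (ub_le_sup (dual_has_sup f).2); exists 0 => //=; rewrite normr0.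
Qed.

Lemma le_dual_norm f x : `|f x| <= dual_norm f * `|x|.
Proof.
have [->|x0] := eqVneq x 0; first by rewrite linear0 !normr0 mulr0.
have nx : 0 < `|x| by rewrite normr_gt0.
rewrite -ler_pdivrMr//.
have -> : `|f x| / `|x| = `|f (`|x|^-1 *: x)|.
  by rewrite linearZ /= normrM ger0_norm ?invr_ge0// mulrC.
rewrite normRe /dual_norm lecR; apply: (ub_le_sup (dual_has_sup f).2).
exists (`|x|^-1 *: x) => //=; rewrite normrZ ger0_norm ?invr_ge0//.
by rewrite mulVf// gt_eqF.
Qed.

Lemma dual_norm_le f (M : R[i]) :
  0 <= M -> (forall x, `|f x| <= M * `|x|) -> dual_norm f <= M.
Proof.
move=> M0 fM; rewrite /dual_norm -[leRHS]RRe_real ?ger0_real// lecR.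
apply: ge_sup; first exact: (dual_has_sup f).1.
move=> _ [x /= x1 <-]; rewrite -lecR -normRe RRe_real ?ger0_real//.
by rewrite (le_trans (fM x))// ler_piMr.
Qed.

Lemma dual_normD f g : dual_norm (f + g) <= dual_norm f + dual_norm g.
Proof.
apply: dual_norm_le => [|x]; first by rewrite addr_ge0// dual_norm_ge0.
by rewrite dualDE mulrDl (le_trans (ler_normD _ _))// lerD// le_dual_norm.
Qed.

Lemma dual_norm0_eq0 f : dual_norm f = 0 -> f = 0.
Proof.
move=> f0; apply: dualP => x; apply/eqP; rewrite -normr_le0.
by rewrite (le_trans (le_dual_norm f x))// f0 mul0r.
Qed.

Lemma dual_normZ k f : dual_norm (k *: f) = `|k| * dual_norm f.
Proof.
have le_ k' f' : dual_norm (k' *: f') <= `|k'| * dual_norm f'.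
  apply: dual_norm_le => [|x]; first by rewrite mulr_ge0// dual_norm_ge0.
  by rewrite dualZE normrM -mulrA ler_wpM2l// le_dual_norm.
have [->|k0] := eqVneq k 0.
  apply/eqP; rewrite eq_le le_ normr0 mul0r; exact: dual_norm_ge0.
apply/eqP; rewrite eq_le le_ /= -ler_pdivlMl ?normr_gt0//.
by have := le_ k^-1 (k *: f); rewrite scalerA mulVf// scale1r normfV.
Qed.

HB.instance Definition _ := @Lmodule_isNormed.Build R[i] dual
  dual_norm dual_normD dual_normZ dual_norm0_eq0.

Lemma le_dual f x : `|f x| <= `|f| * `|x|.
Proof. exact: le_dual_norm. Qed.

Lemma dual_le f (M : R[i]) :
  0 <= M -> (forall x, `|f x| <= M * `|x|) -> `|f| <= M.
Proof. exact: dual_norm_le. Qed.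

Lemma bounded_cont_linear (f : X -> R[i]^o) (M : R[i]) : 0 <= M ->
  linear f -> (forall x, `|f x| <= M * `|x|) -> f \in cont_linear.
Proof.
move=> M0 lf fM; apply/asboolP; split=> //.
pose lfL := GRing.isLinear.Build R[i] X R[i]^o _ f lf.
pose F : {linear X -> R[i]^o} := HB.pack f lfL.
apply: (@bounded_linear_continuous _ _ _ F); apply/ex_bound.
exists M; apply/nbhs_norm0P; exists 1 => //= x /= x1.
by rewrite (le_trans (fM x))// ler_piMr// ltW.
Qed.

Lemma dual_complete (F : set_system dual) :
  ProperFilter F -> cauchy F -> cvg F.
Proof.
move=> FF /cauchyP Fc.
have ev_cvg (x : X) : cvg ((fun f : dual => f x) @ F).
  have FxF : ProperFilter ((fun f : dual => f x) @ F).
    exact: fmap_proper_filter.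
  apply: (complex_complete FxF); apply/cauchyP => e e0.
  have x1 : 0 < `|x| + 1 by rewrite ltr_wpDl.
  have [|f Ff] := Fc (e / (`|x| + 1)); first by rewrite divr_gt0.
  exists (f x).
  suff : F ((fun f : dual => f x) @^-1` ball (f x : R[i]^o) e) by [].
  apply: filterS Ff => g; rewrite /preimage -!ball_normE /= => fg.
  rewrite -[_ - _]/((f - g) x) (le_lt_trans (le_dual _ _))//.
  rewrite (@le_lt_trans _ _ (`|f - g| * (`|x| + 1)))//.
    by rewrite ler_wpM2l// lerDl.
  by rewrite -ltr_pdivlMr.
pose g x : R[i]^o := lim ((fun f : dual => f x) @ F).
have gP x : (fun f : dual => f x) @ F --> g x by exact: ev_cvg.
have lg : linear g.
  move=> k x y; apply/esym; apply: (cvg_unique _ _ (gP (k *: x + y))) => //.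
  have -> : (fun f : dual => f (k *: x + y)) = (fun f : dual => k *: f x + f y).
    by apply/funext => f; rewrite linearP.
  by apply: cvgD; [apply: cvgZr; exact: gP | exact: gP].
have near_g e f x : 0 < e -> F (ball f e) -> `|f x - g x| <= e * `|x|.
  move=> e0 Ff; apply: (cvg_dist_le (gP x)).
    by rewrite realM ?normr_real// gtr0_real.
  apply: filterS Ff => h; rewrite -ball_normE /= => fh.
  by rewrite -[_ - _]/((f - h) x) (le_trans (le_dual _ _))// ler_wpM2r// ltW.
have [f1 Ff1] := Fc 1 ltr01.
have gM x : `|g x| <= (`|f1| + 1) * `|x|.
  rewrite -[g x](subKr (f1 x)) (le_trans (ler_normB _ _))// mulrDl lerD//.
    exact: le_dual.
  exact: near_g.
pose G := Dual (bounded_cont_linear (addr_ge0 (normr_ge0 f1) ler01) lg gM).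
apply/cvg_ex; exists G; apply/cvgrPdist_lt => e e0.
have e20 : 0 < e / 2 by rewrite divr_gt0.
have [f Ff] := Fc _ e20.
apply: filterS (Ff) => h; rewrite -ball_normE /= => fh.
rewrite -[G - h](subrKA f) (le_lt_trans (ler_normD _ _))//.
rewrite [e]splitr ler_ltD// distrC; apply: dual_le => [|x]; first exact: ltW.
exact: near_g.
Qed.

HB.instance Definition _ := Uniform_isComplete.Build dual dual_complete.

End dual_type.

Section bidual.
Variable R : realType.

Definition bidual (A : normedModType R[i]) := dual (dual A).
HB.instance Definition _ (A : normedModType R[i]) :=
  CompleteNormedModule.on (bidual A).

Variable A : banachAlgType R[i].
Implicit Types (a b : A) (f g : dual A) (m n p : bidual A).

Fact dact_linear f a : linear (fun b => f (a ** b) : R[i]^o).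
Proof. by move=> k x y; rewrite bmulDr -bscaleAr linearP. Qed.

Fact dact_bound f a b : `|f (a ** b)| <= `|f| * `|a| * `|b|.
Proof. by rewrite -mulrA (le_trans (le_dual _ _))// ler_wpM2l// bnormM. Qed.

(* <f . a, b> = <f, a b> *)
Definition dact f a : dual A := Dual (bounded_cont_linear
  (mulr_ge0 (normr_ge0 f) (normr_ge0 a)) (dact_linear f a) (dact_bound f a)).

Lemma dactE f a b : dact f a b = f (a ** b). Proof. by []. Qed.

Lemma dact_norm f a : `|dact f a| <= `|f| * `|a|.
Proof. by apply: dual_le => [|b]; [rewrite mulr_ge0|exact: dact_bound]. Qed.

Lemma dactDr f k a b : dact f (k *: a + b) = k *: dact f a + dact f b.
Proof.
by apply: dualP => c; rewrite dualDE dualZE !dactE bmulDl -bscaleAl linearP.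
Qed.

Lemma dactDl f g k a : dact (k *: f + g) a = k *: dact f a + dact g a.
Proof. by apply: dualP. Qed.

Lemma dactA f a b : dact (dact f a) b = dact f (a ** b).
Proof. by apply: dualP => c; rewrite !dactE bmulA. Qed.

Fact bdact_linear m f : linear (fun a => m (dact f a) : R[i]^o).
Proof. by move=> k a b; rewrite dactDr linearP. Qed.

Fact bdact_bound m f a : `|m (dact f a)| <= `|m| * `|f| * `|a|.
Proof. by rewrite -mulrA (le_trans (le_dual _ _))// ler_wpM2l// dact_norm. Qed.

(* <m . f, a> = <m, f . a> *)
Definition bdact m f : dual A := Dual (bounded_cont_linear
  (mulr_ge0 (normr_ge0 m) (normr_ge0 f)) (bdact_linear m f) (bdact_bound m f)).

Lemma bdactE m f a : bdact m f a = m (dact f a). Proof. by []. Qed.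

Lemma bdact_norm m f : `|bdact m f| <= `|m| * `|f|.
Proof. by apply: dual_le => [|b]; [rewrite mulr_ge0|exact: bdact_bound]. Qed.

Lemma bdactDr m k f g : bdact m (k *: f + g) = k *: bdact m f + bdact m g.
Proof.
by apply: dualP => c; rewrite dualDE dualZE !bdactE dactDl linearP.
Qed.

Lemma bdact_dact m f a : dact (bdact m f) a = bdact m (dact f a).
Proof. by apply: dualP => b; rewrite dactE !bdactE dactA. Qed.

Fact arens_linear n m : linear (fun f => n (bdact m f) : R[i]^o).
Proof. by move=> k f g; rewrite bdactDr linearP. Qed.

Fact arens_bound n m f : `|n (bdact m f)| <= `|n| * `|m| * `|f|.
Proof. by rewrite -mulrA (le_trans (le_dual _ _))// ler_wpM2l// bdact_norm. Qed.

(* first Arens product: <n . m, f> = <n, m . f> *)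
Definition arens n m : bidual A := Dual (bounded_cont_linear
  (mulr_ge0 (normr_ge0 n) (normr_ge0 m)) (arens_linear n m) (arens_bound n m)).

Lemma arensE n m f : arens n m f = n (bdact m f). Proof. by []. Qed.

Lemma arens_bdact n m f : bdact (arens n m) f = bdact n (bdact m f).
Proof. by apply: dualP => a; rewrite !bdactE arensE bdact_dact. Qed.

Lemma arensA : associative arens.
Proof. by move=> m n p; apply: dualP => f; rewrite !arensE arens_bdact. Qed.

Lemma arensDl : left_distributive arens +%R.
Proof. by move=> m n p; apply: dualP. Qed.

Lemma arensDr : right_distributive arens +%R.
Proof.
move=> m n p; apply: dualP => f; rewrite dualDE !arensE -linearD; congr (m _).
exact: dualP.
Qed.

Lemma arensZl k n m : k *: arens n m = arens (k *: n) m.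
Proof. by apply: dualP. Qed.

Lemma arensZr k n m : k *: arens n m = arens n (k *: m).
Proof.
apply: dualP => f; rewrite dualZE !arensE -dual_scale; congr (n _).
exact: dualP.
Qed.

Lemma arens_norm n m : `|arens n m| <= `|n| * `|m|.
Proof. by apply: dual_le => [|f]; [rewrite mulr_ge0|exact: arens_bound]. Qed.

HB.instance Definition _ := @CompleteNormedModule_isBanachAlgebra.Build R[i]
  (bidual A) arens arensA arensDl arensDr arensZl arensZr arens_norm.

End bidual.

Section character.
Variables (R : realType) (B : banachAlgType R[i]) (phi : nzHom B).

Lemma nzhomZ k b : phi (k *: b) = k * phi b. Proof. exact: linearZ. Qed.

Lemma nzhom_le b : `|phi b| <= `|b|.
Proof.
have [//|bphi] := real_leP (normr_real (phi b)) (normr_real b).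
have p0 : phi b != 0 by rewrite -normr_gt0 (le_lt_trans _ bphi).
pose x := (phi b)^-1 *: b.
have phix : phi x = 1 by rewrite linearZ; exact: mulVf.
have x1 : `|x| < 1 by rewrite normrZ normfV ltr_pdivrMl ?normr_gt0// mulr1.
pose y n := iter n (fun z => x + x ** z) 0.
pose q := `|x|; have q1 : 0 < 1 - q by rewrite subr_gt0.
pose M := q / (1 - q).
have M0 : 0 <= M by exact: divr_ge0 (normr_ge0 x) (ltW q1).
have yM n : `|y n| <= M.
  elim: n => [|n IH]; first by rewrite normr0.
  rewrite /= (le_trans (ler_normD _ _))// (_ : M = q + q * M).
    by rewrite lerD// (le_trans (bnormM _ _))// ler_wpM2l.
  rewrite /M; field; by rewrite gt_eqF.
have bDN (u v : B) : x ** u - x ** v = x ** (u - v).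
  by rewrite bmulDr -scaleN1r bscaleAr scaleN1r.
have yD n k : `|y (n + k)%N - y n| <= q ^+ n * M.
  elim: n => [|n IH]; first by rewrite add0n subr0 expr0 mul1r.
  rewrite addSn /= opprD addrACA subrr add0r bDN.
  rewrite (le_trans (bnormM _ _))// exprS -mulrA.
  by rewrite ler_wpM2l.
have qn (e : R[i]) : 0 < e -> exists n, q ^+ n * M < e.
  move=> e0; pose r := complex.Re q.
  have rq : q = r%:C by rewrite RRe_real// normr_real.
  have r1 : `|r| < 1.
    rewrite ger0_norm; first by rewrite -ltcR -rq.
    by rewrite -lecR -rq normr_ge0.
  have er : (complex.Re e)%:C = e by rewrite RRe_real// gtr0_real.
  have Mr : (complex.Re M)%:C = M by rewrite RRe_real// ger0_real.
  have e0' : 0 < complex.Re e by rewrite -ltcR er.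
  have /cvgrPdist_lt/(_ _ e0') := cvg_geometric (complex.Re M) r1.
  move=> /filter_ex[n]; rewrite /= sub0r normrN => rn; exists n.
  rewrite rq -rmorphXn -Mr mulrC -rmorphM -er ltcR.
  exact: le_lt_trans (ler_norm _) rn.
have ycvg : cvgn y.
  apply: cauchy_cvg; apply/cauchyP => e /qn[n ne]; exists (y n).
  exists n => // m /= nm; rewrite -ball_normE /= distrC.
  by rewrite -(subnKC nm) (le_lt_trans (yD _ _)).
have yl : y @ \oo --> limn y by exact: ycvg.
suff : x + x ** limn y = limn y.
  move=> /(congr1 phi); rewrite linearD nzhomM phix mul1r => h.
  have := subrr (phi (limn y)); rewrite -{1}h addrK => /eqP.
  by rewrite oner_eq0.
apply/eqP; rewrite -subr_eq0 -normr_le0.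
apply: lec_eps => [||e e0]; [exact: normr_real|by []|rewrite add0r].
have ySl : (fun n => y n.+1) @ \oo --> limn y by rewrite cvg_shiftS.
apply: (cvg_dist_le ySl); first exact: gtr0_real.
have /cvgrPdist_lt/(_ e e0) := yl; apply: filterS => n /= nl.
rewrite opprD addrACA subrr add0r bDN.
rewrite (le_trans (bnormM _ _))// (le_trans _ (ltW nl))//.
by rewrite ler_piMl// ltW.
Qed.

Lemma nzhom_bound b : `|phi b| <= 1 * `|b|.
Proof. by rewrite mul1r nzhom_le. Qed.

Definition dual_of_nzHom : dual B :=
  Dual (bounded_cont_linear ler01 (@linearP _ _ _ _ phi) nzhom_bound).

Definition eval_nzHom (m : bidual B) : R[i]^o := m dual_of_nzHom.

Fact eval_nzHom_linear : linear eval_nzHom.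
Proof. by []. Qed.

HB.instance Definition _ :=
  GRing.isLinear.Build R[i] (bidual B) R[i]^o _ eval_nzHom eval_nzHom_linear.

Fact eval_nzHomM m n : eval_nzHom (m ** n) = eval_nzHom m * eval_nzHom n.
Proof.
have dphi b : dact dual_of_nzHom b = phi b *: dual_of_nzHom.
  by apply: dualP => c; rewrite dualZE dactE /= nzhomM.
rewrite /eval_nzHom [LHS]arensE mulrC -dual_scale; congr (m _).
by apply: dualP => b; rewrite bdactE dphi dualZE linearZ /= mulrC.
Qed.

Fact canon_linear (b : B) : linear (fun f : dual B => f b : R[i]^o).
Proof. by []. Qed.

Fact canon_bound (b : B) (f : dual B) : `|f b| <= `|b| * `|f|.
Proof. by rewrite mulrC le_dual. Qed.

Fact eval_nzHom_neq0 : exists m, eval_nzHom m != 0.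
Proof.
have [b b0] := nzhom_neq0 phi.
by exists (Dual (bounded_cont_linear
  (normr_ge0 b) (@canon_linear b) (@canon_bound b))).
Qed.

(* The character m |-> m(phi) of the bidual: with it, the algebra
   A^** (+)_phi B^** is phi_sum (bidual A) (nzHom_bidual phi). *)
Definition nzHom_bidual : nzHom (bidual B) :=
  @NzHom _ (bidual B) eval_nzHom eval_nzHomM eval_nzHom_neq0.

End character.

(* The algebra of pairs A (+)_phi B. The alias keeps it apart from A * B, on
   which the library puts the maximum norm. *)
Definition phi_sum (R : realType) (A B : banachAlgType R[i]) (phi : nzHom B)
  : Type := (A * B)%type.
Arguments phi_sum {R} A {B} phi.

Section phi_sum.
Variables (R : realType) (A B : banachAlgType R[i]) (phi : nzHom B).
Local Notation S := (phi_sum A phi).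
Implicit Types u v w : S.

HB.instance Definition _ := GRing.Lmodule.copy S (A * B)%type.

Definition phi_norm u : R[i] := `|u.1| + `|u.2|.

Fact phi_normD u v : phi_norm (u + v) <= phi_norm u + phi_norm v.
Proof. by rewrite /phi_norm addrACA lerD// ler_normD. Qed.

Fact phi_normZ k u : phi_norm (k *: u) = `|k| * phi_norm u.
Proof. by rewrite /phi_norm !normrZ mulrDr. Qed.

Fact phi_norm0_eq0 u : phi_norm u = 0 -> u = 0.
Proof.
case: u => a b /eqP; rewrite /phi_norm paddr_eq0//= !normr_eq0.
by move=> /andP[/eqP-> /eqP->].
Qed.

HB.instance Definition _ := @Lmodule_isNormed.Build R[i] S
  phi_norm phi_normD phi_normZ phi_norm0_eq0.

Lemma phi_normE u : `|u| = `|u.1| + `|u.2|. Proof. by []. Qed.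

Fact phi_sum_complete (F : set_system S) : ProperFilter F -> cauchy F -> cvg F.
Proof.
move=> FF /cauchyP Fc.
have F1 : cvg ((fst : S -> A) @ F).
  have F1F : ProperFilter ((fst : S -> A) @ F) by exact: fmap_proper_filter.
  apply: cauchy_cvg; apply/cauchyP => e /Fc[u Fu]; exists u.1.
  suff : F ((fst : S -> A) @^-1` ball u.1 e) by [].
  apply: filterS Fu => v; rewrite /preimage -!ball_normE /=.
  by apply: le_lt_trans; rewrite phi_normE lerDl.
have F2 : cvg ((snd : S -> B) @ F).
  have F2F : ProperFilter ((snd : S -> B) @ F) by exact: fmap_proper_filter.
  apply: cauchy_cvg; apply/cauchyP => e /Fc[u Fu]; exists u.2.
  suff : F ((snd : S -> B) @^-1` ball u.2 e) by [].
  apply: filterS Fu => v; rewrite /preimage -!ball_normE /=.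
  by apply: le_lt_trans; rewrite phi_normE lerDr.
move: F1 F2 => /cvg_ex[a Fa] /cvg_ex[b Fb].
apply/cvg_ex; exists ((a, b) : S); apply/cvgrPdist_lt => e e0.
have e20 : 0 < e / 2 by rewrite divr_gt0.
have /cvgrPdist_lt/(_ _ e20) ha := Fa.
have /cvgrPdist_lt/(_ _ e20) hb := Fb.
by apply: filterS2 ha hb => u ua ub; rewrite phi_normE [e]splitr ltrD.
Qed.

HB.instance Definition _ := Uniform_isComplete.Build S phi_sum_complete.

Definition phi_mul u v : S :=
  (u.1 ** v.1 + phi u.2 *: v.1 + phi v.2 *: u.1, u.2 ** v.2).

Fact phi_mulDl : left_distributive phi_mul +%R.
Proof.
move=> u v w; congr pair => /=; last exact: bmulDl.
rewrite bmulDl (linearD phi) scalerDl scalerDr -!addrA; congr (_ + _).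
rewrite [LHS]addrCA; congr (_ + _); rewrite [RHS]addrCA; congr (_ + _).
by rewrite addrCA.
Qed.

Fact phi_mulDr : right_distributive phi_mul +%R.
Proof.
move=> u v w; congr pair => /=; last exact: bmulDr.
rewrite bmulDr (linearD phi) scalerDl scalerDr.
by rewrite [RHS]addrACA; congr (_ + _); rewrite addrACA.
Qed.

Fact phi_scaleAl k u v : k *: phi_mul u v = phi_mul (k *: u) v.
Proof.
congr pair => /=; last exact: bscaleAl.
rewrite !scalerDr nzhomZ bscaleAl !scalerA; congr (_ + _ + _ *: _).
by rewrite mulrC.
Qed.

Fact phi_scaleAr k u v : k *: phi_mul u v = phi_mul u (k *: v).
Proof.
congr pair => /=; last exact: bscaleAr.
rewrite !scalerDr nzhomZ bscaleAr !scalerA; congr (_ + _ *: _ + _).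
by rewrite mulrC.
Qed.

Fact phi_mulA : associative phi_mul.
Proof.
move=> u v w; congr pair => /=; last exact: bmulA.
rewrite !nzhomM !bmulDl !bmulDr !scalerDr -!bscaleAl -!bscaleAr !bmulA !scalerA.
rewrite (mulrC (phi u.2) (phi w.2)) (mulrC (phi v.2) (phi w.2)).
rewrite -!addrA; congr (_ + _); rewrite [RHS]addrCA; congr (_ + _).
by rewrite [LHS]addrCA; congr (_ + _); rewrite addrCA.
Qed.

Fact phi_normM u v : `|phi_mul u v| <= `|u| * `|v|.
Proof.
rewrite !phi_normE mulrDl !mulrDr /= addrA.
apply: lerD; last exact: bnormM.
rewrite (le_trans (ler_normD _ _))// -[leRHS]addrA [X in _ <= _ + X]addrC addrA.
apply: lerD; last by rewrite normrZ mulrC ler_wpM2l// nzhom_le.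
rewrite (le_trans (ler_normD _ _))// lerD ?bnormM//.
by rewrite normrZ ler_wpM2r// nzhom_le.
Qed.

HB.instance Definition _ := @CompleteNormedModule_isBanachAlgebra.Build R[i]
  S phi_mul phi_mulA phi_mulDl phi_mulDr phi_scaleAl phi_scaleAr phi_normM.

End phi_sum.

Definition isometrically_isomorphic (K : numFieldType)
    (C D : banachAlgType K) : Prop :=
  exists T : {linear C -> D}, [/\ bijective T,
    forall x y, T (x ** y) = T x ** T y & forall x, `|T x| = `|x|].

(* Main.v *)
Require Import Defs.
From mathcomp Require Import all_boot all_order all_algebra complex.
From mathcomp Require Import reals topology normedtype.
From HB Require Import structures.

(** The coordinate maps i1, i2, p1, p2 between A, B and S = A (+)_phi B are
    linear contractions, hence so are their second adjoints. The isomorphism is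
    T (m1, m2) = i1** m1 + i2** m2, with inverse M |-> (p1** M, p2** M). It is
    isometric because the dual of an l^1-sum carries the maximum norm, so m1 and
    m2 can be tested independently on two functionals of norm at most 1 whose
    values are rotated to be nonnegative. It is multiplicative because, for F in
    S* with components F1 = F o i1 and F2 = F o i2, the functional (T m') . F has
    components m1' . F1 + m2'(phi) F1 and m1'(F1) phi + m2' . F2. *)

Set Implicit Arguments.
Unset Strict Implicit.
Unset Printing Implicit Defensive.

Import Order.TTheory GRing.Theory Num.Theory.

Local Open Scope ring_scope.
Local Open Scope complex_scope.

(** * Preliminaries on zero products and dual norms *)

Lemma dual_additive (R : realType) (X : normedModType R[i]) (f : dual X) x y :
  f (x + y) = f x + f y.
Proof. exact: linearD. Qed.

Lemma bmulr0 (K : numFieldType) (C : banachAlgType K) (x : C) : x ** 0 = 0.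
Proof. by rewrite -[X in x ** X](scale0r 0) -bscaleAr scale0r. Qed.

Lemma bmul0r (K : numFieldType) (C : banachAlgType K) (x : C) : 0 ** x = 0.
Proof. by rewrite -[X in X ** x](scale0r 0) -bscaleAl scale0r. Qed.

Lemma dact0r (R : realType) (C : banachAlgType R[i]) (f : dual C) :
  dact f 0 = 0.
Proof. by apply: dualP => c; rewrite dactE bmul0r linear0. Qed.

Lemma dual_le_ball (R : realType) (X : normedModType R[i]) (f : dual X)
    (M : R[i]) :
  0 <= M -> (forall x, `|x| <= 1 -> `|f x| <= M) -> `|f| <= M.
Proof.
move=> M0 fM; apply: dual_le => // x.
have [->|x0] := eqVneq x 0; first by rewrite linear0 !normr0 mulr0.
have nx : 0 < `|x| by rewrite normr_gt0.
have := fM (`|x|^-1 *: x); rewrite normrZ normfV normr_id mulVf ?gt_eqF//.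
rewrite dual_scale normrM normfV normr_id => /(_ (lexx _)).
by rewrite mulrC ler_pdivrMr.
Qed.

(** For [m f] nonzero, scale [f] by [|m f| / m f], which has modulus 1. *)
Lemma dual_rotate (R : realType) (X : normedModType R[i]) (m : bidual X)
    (f : dual X) :
  exists2 g : dual X, `|g| <= `|f| & m g = `|m f|.
Proof.
have [mf0|mf0] := eqVneq (m f) 0.
  by exists 0; rewrite ?normr0// mf0 normr0 linear0.
exists ((`|m f| / m f) *: f); last by rewrite dual_scale divfK.
by rewrite normrZ normrM normfV normr_id mulfV ?mul1r// normr_eq0.
Qed.

(** * Adjoints of linear contractions *)

Section adjoint.
Variables (R : realType) (X Y : normedModType R[i]) (j : X -> Y).
Hypotheses (j_lin : linear j) (j_le : forall x, `|j x| <= `|x|).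

Fact adjoint_linear (f : dual Y) : linear (fun x => f (j x) : R[i]^o).
Proof. by move=> k x y; rewrite j_lin linearP. Qed.

Fact adjoint_bound (f : dual Y) x : `|f (j x)| <= `|f| * `|x|.
Proof. by rewrite (le_trans (le_dual _ _))// ler_wpM2l. Qed.

(* Locked, because otherwise unification of [f (j x)] with [adjoint f x] can
   unfold the norm structures and run forever. *)
Definition adjoint (f : dual Y) : dual X := locked
  (Dual (bounded_cont_linear
    (normr_ge0 f) (adjoint_linear f) (adjoint_bound f))).

Lemma adjointE f x : adjoint f x = f (j x).
Proof. by rewrite /adjoint -lock. Qed.

Lemma adjoint_is_linear : linear adjoint.
Proof. by move=> k f g; apply: dualP => x; rewrite dualDE dualZE !adjointE. Qed.

Lemma adjointD f g : adjoint (f + g) = adjoint f + adjoint g.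
Proof. by apply: dualP => x; rewrite dualDE !adjointE. Qed.

Lemma adjoint_le f : `|adjoint f| <= `|f|.
Proof. by apply: dual_le => // x; rewrite adjointE adjoint_bound. Qed.

End adjoint.

(** The adjoint of a linear contraction is again one, so [adjoint] can be iterated. *)
Definition biadjoint (R : realType) (X Y : normedModType R[i]) (j : X -> Y)
    (j_lin : linear j) (j_le : forall x, `|j x| <= `|x|) :
    bidual X -> bidual Y :=
  adjoint (adjoint_is_linear j_lin j_le) (adjoint_le j_lin j_le).

(** * The linear bijection between the biduals *)

Section bidual_phi_sum.
Variables (R : realType) (A B : banachAlgType R[i]) (phi : nzHom B).
Local Notation S := (phi_sum A phi).
Local Notation SS := (phi_sum (bidual A) (nzHom_bidual phi)).

Definition phi_inl (a : A) : S := (a, 0).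
Definition phi_inr (b : B) : S := (0, b).
Definition phi_fst (u : S) : A := u.1.
Definition phi_snd (u : S) : B := u.2.

Fact phi_inl_linear : linear phi_inl.
Proof. by move=> k a b; congr pair; rewrite /= scaler0 addr0. Qed.

Fact phi_inr_linear : linear phi_inr.
Proof. by move=> k a b; congr pair; rewrite /= scaler0 addr0. Qed.

Fact phi_fst_linear : linear phi_fst. Proof. by []. Qed.

Fact phi_snd_linear : linear phi_snd. Proof. by []. Qed.

Fact phi_inl_le a : `|phi_inl a| <= `|a|.
Proof. by rewrite phi_normE /= normr0 addr0. Qed.

Fact phi_inr_le b : `|phi_inr b| <= `|b|.
Proof. by rewrite phi_normE /= normr0 add0r. Qed.

Fact phi_fst_le u : `|phi_fst u| <= `|u|.
Proof. by rewrite phi_normE lerDl. Qed.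

Fact phi_snd_le u : `|phi_snd u| <= `|u|.
Proof. by rewrite phi_normE lerDr. Qed.

Local Notation inl_adj := (adjoint phi_inl_linear phi_inl_le).
Local Notation inr_adj := (adjoint phi_inr_linear phi_inr_le).
Local Notation fst_adj := (adjoint phi_fst_linear phi_fst_le).
Local Notation snd_adj := (adjoint phi_snd_linear phi_snd_le).

Definition bidual_of_pair (m : SS) : bidual S :=
  biadjoint phi_inl_linear phi_inl_le m.1 +
  biadjoint phi_inr_linear phi_inr_le m.2.

Definition pair_of_bidual (M : bidual S) : SS :=
  (biadjoint phi_fst_linear phi_fst_le M,
   biadjoint phi_snd_linear phi_snd_le M).

Lemma bidual_of_pairE m F :
  bidual_of_pair m F = m.1 (inl_adj F) + m.2 (inr_adj F).
Proof. by rewrite dualDE !adjointE. Qed.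

Lemma bidual_of_pair_linear : linear bidual_of_pair.
Proof.
move=> k m n; apply: dualP => F.
have fstE : (k *: m + n).1 = k *: (m.1 : bidual A) + (n.1 : bidual A) by [].
have sndE : (k *: m + n).2 = k *: (m.2 : bidual B) + (n.2 : bidual B) by [].
rewrite [RHS]dualDE dualZE !bidual_of_pairE mulrDr [RHS]addrACA fstE sndE.
by rewrite -dualZE -dualDE -dualZE -dualDE.
Qed.

HB.instance Definition _ := GRing.isLinear.Build R[i] SS (bidual S) _
  bidual_of_pair bidual_of_pair_linear.

Lemma dual_phi_sumE (F : dual S) (u : S) :
  F u = inl_adj F u.1 + inr_adj F u.2.
Proof.
have {1}-> : u = phi_inl u.1 + phi_inr u.2.
  by case: u => a b; congr pair; rewrite /= ?addr0 ?add0r.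
by rewrite dual_additive !adjointE.
Qed.

(** Dual form of i1 p1 + i2 p2 = id; it gives surjectivity of [bidual_of_pair]. *)
Lemma dual_phi_sum_split (F : dual S) :
  F = fst_adj (inl_adj F) + snd_adj (inr_adj F).
Proof.
apply: dualP => u; rewrite dual_phi_sumE dualDE.
by rewrite (adjointE phi_fst_linear) (adjointE phi_snd_linear).
Qed.

(** This and the next three lemmas dualize p1 i1 = id, p2 i2 = id, p2 i1 = 0 and p1 i2 = 0. *)
Lemma inl_adj_fst f : inl_adj (fst_adj f) = f.
Proof. by apply: dualP => a; rewrite !adjointE. Qed.

Lemma inr_adj_snd g : inr_adj (snd_adj g) = g.
Proof. by apply: dualP => b; rewrite !adjointE. Qed.

Lemma inl_adj_snd g : inl_adj (snd_adj g) = 0.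
Proof. by apply: dualP => a; rewrite !adjointE linear0. Qed.

Lemma inr_adj_fst f : inr_adj (fst_adj f) = 0.
Proof. by apply: dualP => b; rewrite !adjointE linear0. Qed.

Lemma bidual_of_pairK : cancel bidual_of_pair pair_of_bidual.
Proof.
move=> m; rewrite [RHS]surjective_pairing; congr pair; apply: dualP => f.
  by rewrite adjointE bidual_of_pairE inl_adj_fst inr_adj_fst linear0 addr0.
by rewrite adjointE bidual_of_pairE inl_adj_snd inr_adj_snd linear0 add0r.
Qed.

Lemma pair_of_bidualK : cancel pair_of_bidual bidual_of_pair.
Proof.
move=> M; apply: dualP => F.
by rewrite bidual_of_pairE !adjointE -dual_additive -dual_phi_sum_split.
Qed.

(** * Isometry *)

Lemma dual_pair_le1 (f : dual A) (g : dual B) :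
  `|f| <= 1 -> `|g| <= 1 -> `|fst_adj f + snd_adj g : dual S| <= 1.
Proof.
move=> f1 g1; apply: dual_le => // u; rewrite dualDE !adjointE mul1r.
rewrite (le_trans (ler_normD _ _))// phi_normE lerD//.
  by rewrite (le_trans (le_dual _ _))// ler_piMl.
by rewrite (le_trans (le_dual _ _))// ler_piMl.
Qed.

Lemma bidual_of_pair_norm m : `|bidual_of_pair m| = `|m|.
Proof.
apply/eqP; rewrite eq_le; apply/andP; split.
  apply: dual_le => // F; rewrite bidual_of_pairE phi_normE mulrDl.
  rewrite (le_trans (ler_normD _ _))// lerD// (le_trans (le_dual _ _))//;
    by rewrite ler_wpM2l// adjoint_le.
(* Rotating [f] and [g] separately makes both values nonnegative, so that they add up without
   cancellation. *)
have test (f : dual A) (g : dual B) : `|f| <= 1 -> `|g| <= 1 ->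
    `|m.1 f| + `|m.2 g| <= `|bidual_of_pair m|.
  move=> f1 g1; have [f' /le_trans/(_ f1) f'1 mf'] := dual_rotate m.1 f.
  have [g' /le_trans/(_ g1) g'1 mg'] := dual_rotate m.2 g.
  have := le_dual (bidual_of_pair m) (fst_adj f' + snd_adj g').
  rewrite bidual_of_pairE !adjointD inl_adj_fst inl_adj_snd inr_adj_fst.
  rewrite inr_adj_snd addr0 add0r mf' mg'.
  rewrite ger0_norm ?addr_ge0// => /le_trans; apply.
  by rewrite ler_piMr// dual_pair_le1.
(* Testing with a zero functional isolates one coordinate; this yields the nonnegative bounds that
   [dual_le_ball] requires. *)
have n0 (X : normedModType R[i]) : `|0 : dual X| <= 1 by rewrite normr0.
have m2le (g : dual B) : `|g| <= 1 -> `|m.2 g| <= `|bidual_of_pair m|.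
  by move=> /(test 0 g (n0 _)); apply: le_trans; rewrite lerDr.
(* The two suprema are taken in turn: over [f] with [g] fixed here, then over [g]. *)
have m1le (g : dual B) : `|g| <= 1 ->
    `|m.1| <= `|bidual_of_pair m| - `|m.2 g|.
  move=> g1; apply: dual_le_ball => [|f f1]; first by rewrite subr_ge0 m2le.
  by rewrite lerBrDr test.
rewrite phi_normE addrC -lerBrDr; apply: dual_le_ball => [|g g1].
  by rewrite subr_ge0 (le_trans (m1le 0 (n0 _)))// lerBlDr lerDl.
by rewrite lerBrDl -lerBrDr m1le.
Qed.

(** * Multiplicativity *)

Lemma inl_adj_dact F (u : S) :
  inl_adj (dact F u) = dact (inl_adj F) u.1 + phi u.2 *: inl_adj F.
Proof.
apply: dualP => c; rewrite dualDE dualZE dactE !adjointE dactE.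
rewrite -dual_scale -dual_additive; congr (F _); congr pair => /=.
  by rewrite linear0 scale0r !addr0.
by rewrite bmulr0 scaler0 addr0.
Qed.

(** The product of [u] with [(0, c)] is [(phi c *: u.1, u.2 ** c)]: its first coordinate depends on
    [c] through [phi], whence the multiple of the character. *)
Lemma inr_adj_dact F (u : S) :
  inr_adj (dact F u) =
  inl_adj F u.1 *: dual_of_nzHom phi + dact (inr_adj F) u.2.
Proof.
apply: dualP => c; rewrite dualDE dualZE dactE !adjointE dactE.
rewrite mulrC -dual_scale -dual_additive; congr (F _); congr pair => /=.
  by rewrite bmulr0 scaler0 addr0 add0r addr0.
by rewrite scaler0 add0r.
Qed.

(** At [u = (a, 0)] the components of [dact F u] are [dact (inl_adj F) a] and [inl_adj F a] times
    the character; [n.2] applied to the latter gives the scalar term. *)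
Lemma inl_adj_bdact n F : inl_adj (bdact (bidual_of_pair n) F) =
  bdact n.1 (inl_adj F) + nzHom_bidual phi n.2 *: inl_adj F.
Proof.
apply: dualP => a; rewrite dualDE dualZE adjointE !bdactE bidual_of_pairE.
rewrite inl_adj_dact inr_adj_dact !dual_additive !dual_scale.
rewrite [(_ a).1]/= [(_ a).2]/= dact0r !linear0 mul0r !addr0.
by rewrite mulrC.
Qed.

Lemma inr_adj_bdact n F : inr_adj (bdact (bidual_of_pair n) F) =
  n.1 (inl_adj F) *: dual_of_nzHom phi + bdact n.2 (inr_adj F).
Proof.
apply: dualP => b; rewrite dualDE dualZE adjointE !bdactE bidual_of_pairE.
rewrite inl_adj_dact inr_adj_dact !dual_additive !dual_scale.
rewrite [(_ b).1]/= [(_ b).2]/= dact0r !linear0 mul0r !add0r.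
by rewrite mulrC.
Qed.

Lemma bidual_of_pairM m n :
  bidual_of_pair (m ** n) = bidual_of_pair m ** bidual_of_pair n.
Proof.
apply: dualP => F; rewrite [RHS]arensE !bidual_of_pairE.
rewrite inl_adj_bdact inr_adj_bdact !dual_additive !dual_scale.
have fstE : (m ** n).1 = (m.1 : bidual A) ** n.1 +
    nzHom_bidual phi m.2 *: (n.1 : bidual A) +
    nzHom_bidual phi n.2 *: (m.1 : bidual A) by [].
have sndE : (m ** n).2 = (m.2 : bidual B) ** n.2 by [].
rewrite fstE sndE !dualDE !dualZE arensE -!addrA; congr (_ + _).
(* The two mixed terms occur in opposite orders on the two sides. *)
rewrite addrCA; congr (_ + _); congr (_ + _); exact: mulrC.
Qed.

End bidual_phi_sum.

Theorem proposition4p3 (R : realType) (A B : banachAlgType R[i])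
    (phi : nzHom B) :
  isometrically_isomorphic
    (phi_sum (bidual A) (nzHom_bidual phi))
    (bidual (phi_sum A phi)).
Proof.
exists (@bidual_of_pair R A B phi : {linear _ -> _}); split.
- exact: Bijective (@bidual_of_pairK _ _ _ _) (@pair_of_bidualK _ _ _ _).
- exact: bidual_of_pairM.
- exact: bidual_of_pair_norm.
Qed.
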